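(* Let $d\ge 1$ and $n\ge 1$ be integers. Choose an $n$-multiset of vertices of $T_d$ by drawing each of its $n$ elements uniformly and independently (with replacement) from the $2^d-1$ vertices of $T_d$. Then the probability that the set of distinct drawn vertices is a decodable subset of $T_d$ is $$P_d=\sum_{j=0}^{n-2^{d-1}}\frac{D_{d,j}\,S(n,2^{d-1}+j)\,(2^{d-1}+j)!}{(2^d-1)^n},$$ where $D_{d,j}$ is the number of decodable subsets of $T_d$ with exactly $2^{d-1}+j$ vertices, and $S(a,b)$ is the number of ways to partition a set of $a$ elements into $b$ nonempty subsets (Stirling number of the second kind).
   Context: $T_d$ is the perfect binary tree with $d$ layers and $2^d-1$ vertices. Its $2^{d-1}$ leaves carry the data fragments (binary vectors of a fixed length). Every non-leaf vertex carries the bitwise XOR of the fragments of its two children, hence the XOR of all data fragments at leaves below it. A subset of the vertices of $T_d$ is decodable if the fragments at its vertices determine all $2^{d-1}$ data fragments (equivalently, the indicator vectors over $\mathbb{F}_2$ of the leaf sets below its vertices span $\mathbb{F}_2^{2^{d-1}}$). An empty sum is $0$, and $D_{d,j}=0$ if $j<0$ or $j>2^{d-1}-1$. *)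

(* Defs.v *)
From HB Require Import structures.
From mathcomp Require Import all_boot all_order all_algebra.

Set Implicit Arguments.
Unset Strict Implicit.
Unset Printing Implicit Defensive.

Import GRing.Theory.
Local Open Scope ring_scope.

(* A vertex of T_d is the word of left/right turns leading to it from the
   root, i.e. a bit string of length k < d; layer k has 2 ^ k vertices and the
   leaves are the words of length d - 1. *)
Definition vertex (d : nat) : finType := {k : 'I_d & k.-tuple bool}.

Definition turns (d : nat) (v : vertex d) : seq bool := tagged v.

Definition leaf (d : nat) (v : vertex d) : bool := size (turns v) == d.-1.

Definition is_child (d : nat) (b : bool) (v c : vertex d) : bool :=
  turns c == rcons (turns v) b.

(* Addition in 'rV['F_2]_L is bitwise XOR.  A leaf has no child and any other
   vertex has exactly one child for each b, so the condition below bears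
   exactly on the non-leaf vertices. *)
Definition fragments (L d : nat) (f : {ffun vertex d -> 'rV['F_2]_L}) : bool :=
  [forall v, forall c0, forall c1,
     is_child false v c0 && is_child true v c1 ==> (f v == f c0 + f c1)].

(* Arbitrary data at the leaves x extend to an XOR labelling, given at v by the
   sum of the data at the leaves below v. *)
Lemma fragments_below (L d : nat) (x : vertex d -> 'rV['F_2]_L) :
  let f := [ffun v : vertex d =>
              \sum_(l | leaf l && prefix (turns v) (turns l)) x l] in
  fragments f /\ (forall l, leaf l -> f l = x l).
Proof.
have inj : injective (@turns d).
  move=> [k t] [k' t'] E; rewrite /turns /= in E.
  have Ek : k = k' by apply: val_inj; rewrite /= -(size_tuple t) -(size_tuple t') E.
  by case: _ / Ek in t' E *; congr existT; apply: val_inj.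
have szle (v : vertex d) : (size (turns v) <= d.-1)%N.
  by case: v => k t; rewrite /turns /= size_tuple; case: d k {t inj x} => [[]|d'] //= [].
split.
- apply/'forall_forallP => v c0; apply/forallP => c1.
  apply/implyP => /andP[/eqP e0 /eqP e1]; apply/eqP; rewrite !ffunE e0 e1.
  have szv : (size (turns v) < d.-1)%N.
    by have := szle c0; rewrite e0 size_rcons.
  rewrite (bigID (fun l => nth false (turns l) (size (turns v)))) /= addrC.
  have aux b (l : vertex d) : leaf l ->
    prefix (rcons (turns v) b) (turns l) =
    prefix (turns v) (turns l) && (nth false (turns l) (size (turns v)) == b).
    move=> /eqP szl; rewrite -cats1; apply/prefixP/andP => [[s ->]|[/prefixP[s El]]].
      by rewrite -catA prefix_prefix nth_cat ltnn subnn /=.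
    rewrite El nth_cat ltnn subnn; case: s El => [|b' s] El /=.
      by rewrite El cats0 in szl; rewrite szl ltnn in szv.
    by move=> /eqP <-; exists s; rewrite -catA.
  congr (_ + _); apply: eq_bigl => l; case: (boolP (leaf l)) => //= Hl;
    rewrite aux //; by case: nth.
- move=> l Hl; rewrite ffunE (bigD1 l) /= ?Hl ?prefix_refl // big1 ?addr0 // => m.
  case/andP => /andP[/eqP Hm /prefixP[s E]] /eqP[]; apply: inj; rewrite E.
  move/eqP: Hl => Hl; move: Hm; rewrite E size_cat Hl.
  by case: s {E} => [|b s]; rewrite ?cats0 //= => /eqP; rewrite -[X in _ == X]addn0 eqn_add2l.
Qed.

Definition decodable (L d : nat) (A : {set vertex d}) : bool :=
  [forall f : {ffun vertex d -> 'rV['F_2]_L},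
   forall g : {ffun vertex d -> 'rV['F_2]_L},
     [&& fragments f, fragments g & [forall v in A, f v == g v]]
       ==> [forall (v | leaf v), f v == g v]].

Definition num_decodable (L d j : nat) : nat :=
  #|[set A : {set vertex d} | decodable L A & #|A| == (2 ^ d.-1 + j)%N]|.

Definition stirling2 (a b : nat) : nat :=
  #|[set P : {set {set 'I_a}} | partition P [set: 'I_a] & #|P| == b]|.

Definition uniform (R : realFieldType) (T : finType) (x : T) : R := #|T|%:R^-1.

(* Probability of the outcome w of n independent uniform draws from T. *)
Definition iid_uniform (R : realFieldType) (T : finType) (n : nat)
    (w : {ffun 'I_n -> T}) : R :=
  \prod_(i < n) uniform R (w i).

Definition prob_decodable (R : realFieldType) (L d n : nat) : R :=
  \sum_(w : {ffun 'I_n -> vertex d} | decodable L [set w i | i : 'I_n])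
     iid_uniform R w.

(* Main.v *)
(* A word w of n draws with image A is the same as a partition of the n
   positions into #|A| blocks (the fibres of w) together with a bijection from
   the blocks onto A, so S(n, #|A|) * #|A|! words have image A.  Summing over
   the decodable sets A by size gives the formula: no decodable set has fewer
   than 2 ^ (d - 1) vertices, as the data embed into the labellings of A, and
   no image has more than n elements. *)
Require Import Defs.
From mathcomp Require Import all_boot all_order all_algebra.

Set Implicit Arguments.
Unset Strict Implicit.
Unset Printing Implicit Defensive.

Import GRing.Theory.
Local Open Scope ring_scope.

Lemma card_vertex (d : nat) : #|vertex d| = (2 ^ d - 1)%N.
Proof.
rewrite card_tagged sumnE big_map big_enum /= subn1.
by rewrite predn_exp mul1n; apply: eq_bigr => i _; rewrite card_tuple card_bool.
Qed.

(** Restricting labellings to [A] injects the leaf data into the functions on [A], so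
    [(2 ^ L) ^ (2 ^ d.-1) <= (2 ^ L) ^ #|A|]; comparing exponents requires [0 < L]. *)
Lemma decodable_card_ge (L d : nat) (A : {set vertex d}) :
  (0 < L)%N -> (0 < d)%N -> decodable L A -> (2 ^ d.-1 <= #|A|)%N.
Proof.
case: d A => // d A L_gt0 _ /forallP decA /=.
(* With [d.+1] layers, leaves are exactly the words of length [d]; the default tuple is only reached
   at non-leaf vertices, where [tup] is never evaluated below. *)
pose tup (v : vertex d.+1) : d.-tuple bool :=
  odflt [tuple of nseq d false] (insub (turns v)).
pose lf (t : d.-tuple bool) : vertex d.+1 :=
  existT (fun k : 'I_d.+1 => k.-tuple bool) ord_max t.
have lfK t : tup (lf t) = t by rewrite /tup valK.
have leaf_lf t : leaf (lf t) by rewrite /leaf /turns /= size_tuple.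
pose lab (x : {ffun d.-tuple bool -> 'rV['F_2]_L}) :=
  [ffun v : vertex d.+1 =>
     \sum_(l | leaf l && prefix (turns v) (turns l)) x (tup l)].
have labP x : fragments (lab x) /\ (forall l, leaf l -> lab x l = x (tup l)).
  exact: (fragments_below (fun l => x (tup l))).
pose res x := [ffun v : {v | v \in A} => lab x (val v)].
have res_inj : injective res.
  move=> x y /ffunP exy; apply/ffunP => t.
  have := decA (lab x) => /forallP /(_ (lab y)).
  rewrite (proj1 (labP x)) (proj1 (labP y)) /= => /implyP dxy.
  have /forallP /(_ (lf t)) : [forall (v | leaf v), lab x v == lab y v].
    apply: dxy; apply/forallP => v; apply/implyP => vA.
    by have := exy (Sub v vA); rewrite !ffunE /= => ->.
  rewrite leaf_lf /= => /eqP.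
  by rewrite (proj2 (labP x)) // (proj2 (labP y)) // lfK.
have := leq_card res res_inj.
rewrite !card_ffun card_sig card_tuple card_bool card_mx card_Fp // mul1n.
by rewrite leq_exp2l ?(ltn_exp2l 0 L (ltnSn 1)).
Qed.

Lemma stirling2_small (a b : nat) : (a < b)%N -> stirling2 a b = 0%N.
Proof.
move=> ab; apply/eqP; rewrite cards_eq0; apply/eqP/setP => P; rewrite !inE.
apply/negP => /andP[partP /eqP cP]; move: ab; rewrite -cP ltnNge => /negP[].
rewrite -[leqRHS]card_ord -cardsT (card_partition partP) -sum1_card.
apply: leq_sum => B BP; rewrite card_gt0.
by case/and3P: partP => _ _; apply: contraNneq => <-.
Qed.

(** A word with fibre partition [P] amounts to an injection from the blocks of [P] to [T]; with as
    many blocks as elements of [A], landing in [A] forces it to be onto [A]. *)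
Lemma card_image_eq_preim_partition (I T : finType) (A : {set T})
    (P : {set {set I}}) :
  partition P [set: I] -> #|P| = #|A| ->
  #|[set w : {ffun I -> T} | ([set w i | i : I] == A)
       && (preim_partition w [set: I] == P)]| = #|A|`!.
Proof.
move=> partP cPA; have /and3P[/eqP covP tiP P0] := partP.
have inP i : pblock P i \in P by rewrite pblock_mem ?covP.
pose block := {B : {set I} | B \in P}.
pose blk i : block := Sub (pblock P i) (inP i).
have exB (B : block) : exists i, i \in val B.
  by apply/set0Pn; apply: contraNneq P0 => <-; apply: valP.
(* A representative of each block, used to read off the value of a word on that block. *)
pose pt B := xchoose (exB B).
have ptK : cancel pt blk.
  move=> B; apply: val_inj => /=.
  exact: (def_pblock tiP (valP B) (xchooseP (exB B))).
have cblock : #|{: block}| = #|A| by rewrite card_sig -cPA.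
pose lift_ffun (h : {ffun block -> T}) := [ffun i => h (blk i)].
have lift_inj : injective lift_ffun.
  move=> h k /ffunP ehk; apply/ffunP => B.
  by have := ehk (pt B); rewrite !ffunE ptK.
have := card_inj_ffuns_on block (mem A); rewrite cblock ffactnn => <-.
rewrite -(card_imset _ lift_inj); apply: eq_card => w; rewrite !inE.
apply/andP/imsetP => [[/eqP imw /eqP prew]|[h]].
  have w_blk i j : (w i == w j) = (blk i == blk j).
    have eqvw : {in [set: I] & &, equivalence_rel [rel x y | w x == w y]}.
      by split=> //= /eqP->.
    rewrite -val_eqE /= eq_pblock ?covP // -prew.
    by rewrite (pblock_equivalence_partition eqvw) ?inE.
  exists [ffun B => w (pt B)]; last first.
    by apply/ffunP => i; rewrite !ffunE; apply/eqP; rewrite w_blk ptK.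
  rewrite inE; apply/andP; split.
    by apply/ffun_onP => B; rewrite ffunE -imw imset_f.
  apply/injectiveP => B C; rewrite !ffunE => /eqP.
  by rewrite w_blk !ptK => /eqP.
rewrite inE => /andP[/ffun_onP hA /injectiveP h_inj] ->; split.
  have -> : [set lift_ffun h i | i : I] = [set h B | B : block].
    apply/setP => x; apply/imsetP/imsetP => -[y _ ->].
      by exists (blk y); rewrite ?ffunE.
    by exists (pt y); rewrite // ffunE ptK.
  rewrite eqEcard card_imset // cblock leqnn andbT.
  by apply/subsetP => _ /imsetP[B _ ->].
(* Since [h] is injective, equal letters mean equal blocks, so the fibres of the lifted word are the
   classes of [pblock P]. *)
apply/eqP; rewrite -[RHS](equivalence_partition_pblock partP).
apply: eq_in_imset => i _; apply/setP => j; rewrite !inE /=.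
by rewrite !ffunE (inj_eq h_inj) -val_eqE /= eq_pblock ?covP.
Qed.

Lemma card_preim_partition (I T : finType) (w : {ffun I -> T}) :
  #|preim_partition w [set: I]| = #|[set w i | i : I]|.
Proof.
have -> : preim_partition w [set: I] =
    [set [set i | x == w i] | x in [set w i | i : I]].
  rewrite -imset_comp; apply/setP => B.
  by apply/imsetP/imsetP => -[i _ ->]; exists i; rewrite ?inE //;
    apply/setP => j; rewrite !inE.
(* Distinct values have distinct fibres: [i] lies in its own fibre, hence in that of [j]. *)
apply: card_in_imset => _ _ /imsetP[i _ ->] /imsetP[j _ ->] /setP /(_ i).
by rewrite !inE eqxx => /esym/eqP.
Qed.

Lemma card_image_eq (T : finType) (n : nat) (A : {set T}) :
  #|[set w : {ffun 'I_n -> T} | [set w i | i : 'I_n] == A]| =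
  (stirling2 n #|A| * #|A|`!)%N.
Proof.
rewrite -sum1_card (partition_big (fun w : {ffun 'I_n -> T} =>
  preim_partition w [set: 'I_n])
  (mem [set P : {set {set 'I_n}} | partition P [set: 'I_n] & #|P| == #|A|])) /=.
  rewrite -sum_nat_const; apply: eq_bigr => P.
  rewrite inE => /andP[partP /eqP cP].
  rewrite -(card_image_eq_preim_partition partP cP) -sum1_card.
  by apply: eq_bigl => w; rewrite !inE.
move=> w; rewrite !inE => /eqP <-.
by rewrite preim_partitionP card_preim_partition eqxx.
Qed.

Theorem theorem7 (R : realFieldType) (L d n : nat)
    (hL : (1 <= L)%N) (hd : (1 <= d)%N) (hn : (1 <= n)%N) :
  prob_decodable R L d n =
  \sum_(0 <= j < n.+1 - 2 ^ d.-1)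
     (num_decodable L d j)%:R * (stirling2 n (2 ^ d.-1 + j))%:R
       * ((2 ^ d.-1 + j)`!)%:R / (2 ^+ d - 1) ^+ n.
Proof.
have cV : #|vertex d|%:R = 2 ^+ d - 1 :> R.
  by rewrite card_vertex natrB ?expn_gt0 // natrX.
(* The numerator is written [1%:R] so that, once the denominator is factored out, both sides are
   casts of natural numbers. *)
have iidE (w : {ffun 'I_n -> vertex d}) :
    iid_uniform R w = 1%:R / (2 ^+ d - 1) ^+ n.
  by rewrite /iid_uniform /uniform prodr_const card_ord cV exprVn mul1r.
rewrite /prob_decodable (eq_bigr _ (fun w _ => iidE w)) -!mulr_suml.
congr (_ / _).
under [RHS]eq_bigr do rewrite -!natrM.
rewrite -!natr_sum; congr _%:R.
rewrite (partition_big (fun w : {ffun 'I_n -> vertex d} =>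
  [set w i | i : 'I_n]) (fun A => decodable L A)) //=.
transitivity (\sum_(A : {set vertex d} | decodable L A)
                (stirling2 n #|A| * #|A|`!))%N.
  apply: eq_bigr => A decA; rewrite -card_image_eq -sum1_card.
  apply: eq_bigl => w; rewrite inE.
  by apply: andb_idl => /eqP ->.
transitivity (\sum_(0 <= j < n.+1 - 2 ^ d.-1)
  \sum_(A : {set vertex d} | decodable L A && (#|A| == 2 ^ d.-1 + j))
    (stirling2 n #|A| * #|A|`!))%N; last first.
  apply: eq_bigr => j _; rewrite -mulnA -sum_nat_const.
  by apply: eq_big => [A|A /andP[_ /eqP->]]; rewrite ?inE.
(* With [A] outermost, the inner sum has at most one term, at [j = #|A| - 2 ^ d.-1]; [leA] makes
   this subtraction exact. *)
rewrite (exchange_big_dep (fun A => decodable L A)) /=; last first.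
  by move=> j A _ /andP[].
apply: eq_bigr => A decA; have leA := decodable_card_ge hL hd decA.
have jE j : decodable L A && (#|A| == 2 ^ d.-1 + j)%N =
    (j == #|A| - 2 ^ d.-1)%N.
  by rewrite decA -{1}(subnKC leA) eqn_add2l eq_sym.
(* This [j] is in range exactly when [#|A| <= n]; a larger [A] contributes nothing, its Stirling
   number being zero. *)
rewrite (eq_bigl _ _ jE) big_nat1_eq ltn_sub2rE // ltnS.
by case: (leqP #|A| n) => //= nA; rewrite stirling2_small.
Qed.
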